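(* Let $\varphi:\mathbb{R}^n\to\mathbb{R}$ be of class $\mathcal C^{1,1}$ on a neighborhood of $\bar x$, and let $\bar x$ be a tilt-stable local minimizer of $\varphi$ with modulus $\kappa>0$; set $\bar v=0$. Then there exists $\delta>0$ such that for any $(x,v)\in\operatorname{gph}\nabla\varphi\cap\mathbb B_\delta(\bar x,\bar v)$ and any $q\in\mathbb{R}^n$ with $q\in D^*\big((\nabla\varphi)^{-1}\big)(v,x)(v-\bar v)$ (equivalently, $-v\in D^*\nabla\varphi(x)(-q)$), there exists $y_x\in D^*\nabla\varphi(x)(x-\bar x)$ satisfying $$\|x-\bar x-q\|\le\kappa\,\|\nabla\varphi(x)-\nabla\varphi(\bar x)-y_x\|.$$
   Context: $\varphi$ is of class $\mathcal C^{1,1}$ on a neighborhood of $\bar x$ if it is differentiable there with locally Lipschitz gradient. Regular normal cone $\widehat N_\Omega(\bar x)=\{v:\limsup_{x\to\bar x,x\in\Omega}\langle v,x-\bar x\rangle/\|x-\bar x\|\le0\}$; limiting normal cone $N_\Omega(\bar x)$ = all limits of $v_k\in\widehat N_\Omega(x_k)$ with $x_k\to\bar x$, $x_k\in\Omega$. For $F:\mathbb{R}^n\rightrightarrows\mathbb{R}^m$, $(\bar x,\bar y)\in\operatorname{gph}F$, the limiting coderivative is $D^*F(\bar x,\bar y)(v)=\{u:(u,-v)\in N_{\operatorname{gph}F}(\bar x,\bar y)\}$ (for single-valued $f$ write $D^*f(\bar x)$). $\bar x$ is a tilt-stable local minimizer of $\varphi$ with modulus $\kappa>0$ if for some $\gamma>0$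 the mapping $M_\gamma(v)=\operatorname{argmin}\{\varphi(x)-\langle v,x\rangle:x\in\mathbb B_\gamma(\bar x)\}$ is single-valued and Lipschitz continuous with constant $\kappa$ on a neighborhood of $0$, with $M_\gamma(0)=\{\bar x\}$. *)

(* Defs.v *)
From HB Require Import structures.
From mathcomp Require Import all_boot all_order all_algebra.
From mathcomp Require Import reals.
Set Implicit Arguments. Unset Strict Implicit. Unset Printing Implicit Defensive.
Import Order.TTheory GRing.Theory Num.Theory.
Local Open Scope ring_scope.

Section Defs.
Variables (R : realType) (n : nat).
Notation vec := 'rV[R]_n.

Definition dot (u w : vec) : R := \sum_(i < n) u 0 i * w 0 i.
Definition enorm (u : vec) : R := Num.sqrt (dot u u).

Definition pdot (p q : vec * vec) : R := dot p.1 q.1 + dot p.2 q.2.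
Definition pnorm (p : vec * vec) : R := Num.sqrt (pdot p p).
Definition psub (p q : vec * vec) : vec * vec := (p.1 - q.1, p.2 - q.2).

Definition cball (c : vec) (r : R) (x : vec) : Prop := enorm (x - c) <= r.

Definition is_grad (phi : vec -> R) (x g : vec) : Prop :=
  forall eps : R, 0 < eps -> exists2 d : R, 0 < d &
    forall y : vec, enorm (y - x) < d ->
      `|phi y - phi x - dot g (y - x)| <= eps * enorm (y - x).

Definition C11_near (phi : vec -> R) (gr : vec -> vec) (xbar : vec) : Prop :=
  exists2 r : R, 0 < r &
    (forall x, enorm (x - xbar) < r -> is_grad phi x (gr x)) /\
    (forall x, enorm (x - xbar) < r ->
       exists s : R, exists L : R, 0 < s /\
         forall y z, enorm (y - xbar) < r -> enorm (z - xbar) < r ->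
           enorm (y - x) < s -> enorm (z - x) < s ->
           enorm (gr y - gr z) <= L * enorm (y - z)).

Definition gph_grad (phi : vec -> R) (p : vec * vec) : Prop := is_grad phi p.1 p.2.

Definition gph_inv (G : vec * vec -> Prop) (p : vec * vec) : Prop := G (p.2, p.1).

(* regular (Frechet) normal cone to a set Om of R^n x R^n at pbar:
   limsup_{p -> pbar, p in Om} <w, p - pbar> / |p - pbar| <= 0 *)
Definition reg_normal (Om : vec * vec -> Prop) (pbar w : vec * vec) : Prop :=
  Om pbar /\
  forall eps : R, 0 < eps -> exists2 d : R, 0 < d &
    forall p, Om p -> pnorm (psub p pbar) < d ->
      pdot w (psub p pbar) <= eps * pnorm (psub p pbar).

Definition pconv (s : nat -> vec * vec) (l : vec * vec) : Prop :=
  forall eps : R, 0 < eps -> exists N : nat, forall k, (N <= k)%N ->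
    pnorm (psub (s k) l) < eps.

Definition lim_normal (Om : vec * vec -> Prop) (pbar w : vec * vec) : Prop :=
  Om pbar /\
  exists (ps ws : nat -> vec * vec),
    pconv ps pbar /\ pconv ws w /\
    (forall k, Om (ps k)) /\ (forall k, reg_normal Om (ps k) (ws k)).

Definition coderiv (G : vec * vec -> Prop) (x y w u : vec) : Prop :=
  lim_normal G (x, y) (u, - w).

Definition Mtilt (phi : vec -> R) (xbar : vec) (gamma : R) (v x : vec) : Prop :=
  cball xbar gamma x /\
  forall y, cball xbar gamma y -> phi x - dot v x <= phi y - dot v y.

Definition tilt_stable (phi : vec -> R) (xbar : vec) (kappa : R) : Prop :=
  exists gamma : R, 0 < gamma /\
  exists eps : R, 0 < eps /\
  exists m : vec -> vec,
    (forall v, enorm v < eps -> forall x, Mtilt phi xbar gamma v x <-> x = m v) /\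
    (forall v1 v2, enorm v1 < eps -> enorm v2 < eps ->
        enorm (m v1 - m v2) <= kappa * enorm (v1 - v2)) /\
    (forall x, Mtilt phi xbar gamma 0 x <-> x = xbar).

End Defs.

(* Main.v *)
(* Tilt stability makes the argmin map m a kappa-Lipschitz gradient of the convex
   conjugate of phi, hence cocoercive (Baillon-Haddad); as m inverts grad near
   xbar, <grad x - grad y, x - y> >= |x - y|^2 / kappa there. Put d = x - xbar and
   w = d - q. A regular normal close to (q; -v), taken at a point x_k close to x,
   controls <q, grad> along the segment [x_k - t w, x_k] for small t; adding strong
   monotonicity, <d, grad> increases along it with mean slope at least
   <v, w> + |w|^2 / kappa, up to a small error. A mean value theorem for proximal
   subgradients produces subgradients y of <d, grad> near x with <y, w> at least
   this slope, and a cluster point y lies in D*grad(x)(d). So |w|^2 / kappa <=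
   <y - v, w> <= |y - v| |w|. *)
Require Import Defs.
From HB Require Import structures.
From mathcomp Require Import all_boot all_order all_algebra.
From mathcomp Require Import reals.
From mathcomp Require Import boolp classical_sets topology normedtype.
From mathcomp Require Import ring lra.
Set Implicit Arguments. Unset Strict Implicit. Unset Printing Implicit Defensive.
Import Order.TTheory GRing.Theory Num.Theory numFieldNormedType.Exports.
Local Open Scope ring_scope.

(** * Euclidean inner product and norms on vectors and on pairs *)

Section Euclidean.
Variables (R : realType) (n : nat).
Implicit Types (u v w : 'rV[R]_n) (a : R) (p : 'rV[R]_n * 'rV[R]_n).

Lemma dotC u v : dot u v = dot v u.
Proof. by apply: eq_bigr => i _; rewrite mulrC. Qed.

Lemma dotDl u v w : dot (u + v) w = dot u w + dot v w.
Proof. by rewrite -big_split; apply: eq_bigr => i _; rewrite mxE mulrDl. Qed.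

Lemma dotDr u v w : dot w (u + v) = dot w u + dot w v.
Proof. by rewrite dotC dotDl !(dotC w). Qed.

Lemma dotZl a u w : dot (a *: u) w = a * dot u w.
Proof. by rewrite mulr_sumr; apply: eq_bigr => i _; rewrite mxE mulrA. Qed.

Lemma dotZr a u w : dot w (a *: u) = a * dot w u.
Proof. by rewrite dotC dotZl dotC. Qed.

Lemma dotNl u w : dot (- u) w = - dot u w.
Proof. by rewrite -scaleN1r dotZl mulN1r. Qed.

Lemma dotNr u w : dot w (- u) = - dot w u.
Proof. by rewrite dotC dotNl dotC. Qed.

Lemma dot0l w : dot 0 w = 0.
Proof. by rewrite -(scale0r w) dotZl mul0r. Qed.

Lemma dot0r w : dot w 0 = 0.
Proof. by rewrite dotC dot0l. Qed.

Definition dotE := (dotDl, dotDr, dotNl, dotNr, dotZl, dotZr, dot0l, dot0r).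

Lemma dot_ge0 u : 0 <= dot u u.
Proof. by apply: sumr_ge0 => i _; rewrite -expr2 sqr_ge0. Qed.

Lemma dot_enorm u : dot u u = enorm u ^+ 2.
Proof. by rewrite sqr_sqrtr // dot_ge0. Qed.

Lemma enorm_ge0 u : 0 <= enorm u.
Proof. exact: sqrtr_ge0. Qed.

Lemma enorm0 : enorm (0 : 'rV[R]_n) = 0.
Proof. by rewrite /enorm dot0l sqrtr0. Qed.

Lemma enorm_eq0 u : enorm u = 0 -> u = 0.
Proof.
move=> u0; have /eqP := dot_enorm u; rewrite u0 expr0n psumr_eq0 => [|i _].
  move/allP => h; apply/rowP => i; rewrite mxE.
  by have := h i (mem_index_enum i); rewrite mulf_eq0 orbb => /eqP.
by rewrite -expr2 sqr_ge0.
Qed.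

Lemma enormN u : enorm (- u) = enorm u.
Proof. by rewrite /enorm dotNl dotNr opprK. Qed.

Lemma enormB u v : enorm (u - v) = enorm (v - u).
Proof. by rewrite -enormN opprB. Qed.

Lemma enormZ a u : enorm (a *: u) = `|a| * enorm u.
Proof.
by rewrite /enorm dotZl dotZr mulrA -expr2 sqrtrM ?sqr_ge0 // sqrtr_sqr.
Qed.

Lemma dot_le u v : dot u v <= enorm u * enorm v.
Proof.
have [/enorm_eq0-> | u0] := eqVneq (enorm u) 0; first by rewrite dot0l enorm0 mul0r.
have [/enorm_eq0-> | v0] := eqVneq (enorm v) 0; first by rewrite dot0r enorm0 mulr0.
have up : 0 < enorm u by rewrite lt_def u0 enorm_ge0.
have vp : 0 < enorm v by rewrite lt_def v0 enorm_ge0.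
have := dot_ge0 (enorm v *: u - enorm u *: v).
rewrite !dotE !dot_enorm (dotC v u) => h.
rewrite -(ler_pM2l (mulr_gt0 up vp)); nra.
Qed.

Lemma dot_ge u v : - (enorm u * enorm v) <= dot u v.
Proof. by have := dot_le (- u) v; rewrite enormN dotNl lerNl. Qed.

Lemma ler_enormD u v : enorm (u + v) <= enorm u + enorm v.
Proof.
rewrite -(@ler_pXn2r _ 2) ?nnegrE ?addr_ge0 ?enorm_ge0 //.
rewrite -dot_enorm !dotE !dot_enorm (dotC v u); have := dot_le u v; lra.
Qed.

Lemma ler_enorm_dist v u w : enorm (u - w) <= enorm (u - v) + enorm (v - w).
Proof. by have := ler_enormD (u - v) (v - w); rewrite addrA subrK. Qed.

Lemma pnorm_fst p : enorm p.1 <= pnorm p.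
Proof. by apply: ler_wsqrtr; rewrite lerDl dot_ge0. Qed.

Lemma pnorm_snd p : enorm p.2 <= pnorm p.
Proof. by apply: ler_wsqrtr; rewrite lerDr dot_ge0. Qed.

Lemma pnorm_le p : pnorm p <= enorm p.1 + enorm p.2.
Proof.
have ? := enorm_ge0 p.1; have ? := enorm_ge0 p.2.
rewrite -(@ler_pXn2r _ 2) ?nnegrE ?addr_ge0 ?sqrtr_ge0 //.
rewrite sqr_sqrtr ?addr_ge0 ?dot_ge0 // /pdot !dot_enorm; nra.
Qed.

End Euclidean.

(** * Compactness in the Euclidean norm *)

Section Compactness.
Variables (R : realType) (n : nat).
Local Open Scope classical_set_scope.

(** A sequence-free Bolzano-Weierstrass: the sets [F d] generate a proper filter containing a
    compact box, and [y] is a cluster point of it. It yields minimizers as well as limits of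
    subgradients. *)
Lemma bounded_cluster (F : R -> 'rV[R]_n -> Prop) (M : R) :
  (forall d : R, 0 < d -> exists z, F d z) ->
  (forall (d : R) z, 0 < d -> F d z -> enorm z <= M) ->
  (forall d d' z, d <= d' -> F d z -> F d' z) ->
  exists y, forall d : R, 0 < d -> exists2 z, F d z & enorm (z - y) < d.
Proof.
move=> Fne Fbd Fmono.
pose A : set 'rV[R]_n := [set v | forall i, `[- M, M]%classic (v ord0 i)].
have cA : compact A by apply: (@rV_compact R n (fun=> `[- M, M]%classic)) => i; exact: segment_compact.
pose G : set (set 'rV[R]_n) := [set B | exists2 d : R, 0 < d & F d `<=` B].
have FG : ProperFilter G.
  split; first by case=> d d0 sub; have [z /sub] := Fne d d0.
  split; first by exists 1.
    move=> B C [d d0 dB] [e e0 eC]; exists (Num.min d e); first by rewrite lt_min d0.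
    move=> z Fz; split; [apply: dB | apply: eC]; apply: Fmono Fz; rewrite ge_min lexx ?orbT //.
  by move=> B C BC [d d0 dB]; exists d => // z /dB /BC.
have GA : G A.
  exists 1 => // z Fz i; rewrite /= in_itv /= -ler_norml.
  apply: le_trans (Fbd 1 z ltr01 Fz).
  rewrite -(@ler_pXn2r _ 2) ?nnegrE ?enorm_ge0 // -dot_enorm (real_normK (num_real _)).
  rewrite /dot (bigD1 i) //= -expr2 lerDl; apply: sumr_ge0 => j _.
  by rewrite -expr2 sqr_ge0.
have [y [_ yc]] := cA G FG GA.
exists y => d d0.
(* Neighbourhoods are balls of the max norm; coordinates below [e] give a squared Euclidean norm of
   at most [n * e ^+ 2], which is below [d ^+ 2] even for [n = 0]. *)
pose e := d / n.+1%:R.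
have e0 : 0 < e by rewrite divr_gt0 // ltr0n.
have Gd : G (F d) by exists d.
have [z [Fz yz]] := yc _ _ Gd (nbhsx_ballx y e e0).
exists z => //.
have zy i : `|(z - y) 0 i| < e.
  by have := yz.2 0 i; rewrite !mxE distrC.
rewrite -(@ltr_pXn2r _ 2) ?nnegrE ?enorm_ge0 ?ltW // -dot_enorm.
apply: (@le_lt_trans _ _ (\sum_(i < n) e ^+ 2)).
  apply: ler_sum => i _; rewrite -expr2 -(real_normK (num_real _)).
  by rewrite ler_pXn2r ?nnegrE ?(ltW e0) // ltW.
have -> : d = e * n.+1%:R by rewrite /e divfK // pnatr_eq0.
rewrite sumr_const card_ord -[e ^+ 2 *+ n]mulr_natr (exprMn _ e).
rewrite ltr_pM2l ?exprn_gt0 // -natrX ltr_nat.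
by rewrite -mulnn mulSn leq_addr.
Qed.

(** The near-minimizers, of value at most [inf S + d], cluster at a point of the ball, which is a
    minimizer by continuity. *)
Lemma lipschitz_has_min (f : 'rV[R]_n -> R) (c : 'rV[R]_n) (r L : R) :
  0 <= r -> 0 <= L ->
  (forall y z, cball c r y -> cball c r z -> f y - f z <= L * enorm (y - z)) ->
  exists2 z, cball c r z & forall y, cball c r y -> f z <= f y.
Proof.
move=> r0 L0 fL.
have cc : cball c r c by rewrite /cball subrr enorm0.
pose S := [set f z | z in cball c r].
have Slb : has_inf S.
  split; first by exists (f c), c.
  exists (f c - L * r) => _ [z cz <-].
  have := fL c z cc cz; rewrite enormB; move: cz; rewrite /cball => cz; nra.
pose F (d : R) z := cball c r z /\ f z <= inf S + d.
have [||d d' z dd' [cz fz]|y yF] := @bounded_cluster F (enorm c + r).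
- by move=> d d0; have [_ [z cz <-] /ltW fz] := inf_adherent d0 Slb; exists z.
- move=> d z _ [cz _]; have := ler_enormD c (z - c).
  by rewrite addrC subrK => /le_trans; apply; rewrite lerD2l.
- by split=> //; apply: le_trans fz _; rewrite lerD2l.
have cy : cball c r y.
  apply/ler_addgt0Pr => e e0; have [z [cz _] zy] := yF e e0.
  have := ler_enorm_dist z y c; rewrite (enormB y z); move: cz; rewrite /cball; lra.
exists y => // y' cy'; apply/ler_addgt0Pr => e e0.
have L1 : 0 < L + 1 by lra.
(* [e / (L + 1)] serves both as excess over the infimum and as distance to [y]; the resulting errors
   add up to [e]. *)
have [z [cz fz] zy] := yF _ (divr_gt0 e0 L1).
have Sy' : inf S <= f y' by apply: ge_inf; [exact: Slb.2 | exists y'].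
have := fL y z cy cz; rewrite enormB => fyz.
have : (L + 1) * (e / (L + 1)) = e by rewrite mulrC divfK // gt_eqF.
nra.
Qed.
End Compactness.

(** * A mean value inequality for proximal subgradients *)

Section MeanValue.
Variables (R : realType) (n : nat).

(** Cutting [0, 1] into N equal pieces bounds the total increase by N times C / N^2, which is
    arbitrarily small. This stands in for integrating a derivative. *)
Lemma le_of_quadratic_increments (g : R -> R) (C : R) :
  (forall s t, 0 <= s -> 0 <= t -> s + t <= 1 -> g (s + t) - g s <= C * t ^+ 2) ->
  g 1 <= g 0.
Proof.
move=> gC; apply/ler_addgt0Pr => e e0.
pose N := (Num.bound `|C / e|).+1.
have N0 : 0 < N%:R :> R by rewrite ltr0n.
have CN : C <= e * N%:R.
  rewrite -ler_pdivrMl // mulrC; apply: le_trans (ler_norm _) _.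
  by apply: ltW; apply: lt_le_trans (archi_boundP (normr_ge0 _)) _; rewrite ler_nat.
have step k : (k <= N)%N -> g (k%:R / N%:R) <= g 0 + k%:R * (C / N%:R ^+ 2).
  elim: k => [|k IH] kN; first by rewrite !mul0r addr0.
  have := gC (k%:R / N%:R) N%:R^-1.
  rewrite -[X in _ + X]mul1r -mulrDl natr1 ler_pdivrMr // mul1r ler_nat.
  move=> /(_ _ _ kN); rewrite divr_ge0 ?ler0n // invr_ge0 ler0n => /(_ isT isT).
  have := IH (ltnW kN).
  rewrite -natr1 mulrDl mul1r exprVn; lra.
have := step N (leqnn N); rewrite divff ?gt_eqF // => /le_trans; apply.
rewrite lerD2l (_ : _ * _ = C / N%:R); first by rewrite ler_pdivrMr.
by field; rewrite gt_eqF.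
Qed.

Definition prox_subgrad (f : 'rV[R]_n -> R) (z y : 'rV[R]_n) :=
  exists K s : R, [/\ 0 < K, 0 < s & forall z', enorm (z' - z) < s ->
    f z + dot y (z' - z) - K * enorm (z' - z) ^+ 2 <= f z'].

(* Replacing f by its Moreau envelope e(u) = min_z f(z) + K |z - u|^2, whose
   value at u is off by at most L^2 / K: if z realizes e(u), then 2K(u - z) is
   a proximal subgradient of f at z, and e(u + t w) <= e(u) + t <2K(u - z), w>
   + O(t^2), so that some such slope is at least the mean slope. *)
Lemma prox_mean_value (f : 'rV[R]_n -> R) (c p w : 'rV[R]_n) (s L r : R) :
  0 < s -> 0 < L ->
  (forall y z, enorm (y - c) < s -> enorm (z - c) < s ->
    f y - f z <= L * enorm (y - z)) ->
  enorm (p - c) <= s / 4 -> enorm w <= s / 8 -> r < f (p + w) - f p ->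
  exists z y, [/\ enorm (z - c) < s, prox_subgrad f z y,
    enorm y <= 2 * L & r <= dot y w].
Proof.
move=> s0 L0 fL pc ws rf; apply: contrapT => no.
pose gap := f (p + w) - f p - r.
have gap0 : 0 < gap by rewrite /gap; lra.
(* The first term keeps minimizers within [L / K < s / 8] of [u t], inside the ball of radius
   [s / 4]; the second makes the envelope error [L ^+ 2 / K] smaller than [gap]. *)
pose K := 8 * L / s + L ^+ 2 / gap + 1.
have K0 : 0 < K by rewrite /K !addr_gt0 ?divr_gt0 ?mulr_gt0 ?exprn_gt0.
have sL : 8 * L < K * s.
  rewrite -ltr_pdivrMr // /K; have : 0 < L ^+ 2 / gap by rewrite divr_gt0 ?exprn_gt0.
  lra.
have gapL : L ^+ 2 < K * gap.
  rewrite -ltr_pdivrMr // /K; have : 0 < 8 * L / s by rewrite divr_gt0 ?mulr_gt0.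
  lra.
clearbody K.
pose u (t : R) := p + t *: w.
pose h t z := f z + K * enorm (z - u t) ^+ 2.
have uc t : 0 <= t -> t <= 1 -> enorm (u t - c) <= 3 * s / 8.
  move=> t0 t1; have := ler_enormD (p - c) (t *: w).
  rewrite enormZ ger0_norm // addrAC -/(u t).
  have : t * enorm w <= enorm w by rewrite ler_piMl ?enorm_ge0.
  lra.
(* Keeping the bounds on [t] as premises makes [zf] a total function; its value 0 outside [0, 1] is
   a placeholder. *)
have /choice[zf zfP] : forall t, exists z, 0 <= t -> t <= 1 ->
    cball (u t) (s / 4) z /\ forall y, cball (u t) (s / 4) y -> h t z <= h t y.
  move=> t; case: (boolP ((0 <= t) && (t <= 1))) => [/andP[t0 t1]|nt]; last first.
    by exists 0 => t0 t1; rewrite t0 t1 in nt.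
  have [|||z cz zmin] := @lipschitz_has_min R n (h t) (u t) (s / 4) (L + K * s).
  - by lra.
  - by rewrite addr_ge0 ?mulr_ge0 ?ltW.
  - rewrite /cball /h => y z yu zu.
    have yc := ler_enorm_dist (u t) y c; have zc := ler_enorm_dist (u t) z c.
    have ut := uc t t0 t1.
    have := fL y z; have -> : enorm (y - c) < s by lra.
    have -> : enorm (z - c) < s by lra.
    move=> /(_ isT isT) fyz.
    have tri := ler_enorm_dist z y (u t).
    have ? := enorm_ge0 (y - z); have ? := enorm_ge0 (z - u t); have ? := enorm_ge0 (y - u t).
    have : enorm (y - u t) ^+ 2 - enorm (z - u t) ^+ 2 <= s * enorm (y - z) by nra.
    move=> /(ler_wpM2l (ltW K0)); lra.
  - by exists z.
(* Comparing [zf t] with the centre [u t] gives K |z - u|^2 <= f u - f z <= L |z - u|. *)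
have zu t : 0 <= t -> t <= 1 -> K * enorm (zf t - u t) <= L.
  move=> t0 t1; have [cz zmin] := zfP t t0 t1; move: (cz); rewrite /cball => cz'.
  have := zmin (u t); rewrite {1}/cball subrr enorm0 => /(_ (ltW (divr_gt0 s0 _))).
  rewrite /h subrr enorm0 expr0n mulr0 addr0 ltr0n => /(_ isT) zm.
  have zc := ler_enorm_dist (u t) (zf t) c; have ut := uc t t0 t1.
  have := fL (u t) (zf t); have -> : enorm (u t - c) < s by lra.
  have -> : enorm (zf t - c) < s by lra.
  move=> /(_ isT isT); rewrite (enormB (u t)) => fuz.
  have := enorm_ge0 (zf t - u t); rewrite le_eqVlt => /predU1P[<-|z0].
    by rewrite mulr0 ltW.
  rewrite -(ler_pM2r z0); lra.
have zs t : 0 <= t -> t <= 1 -> enorm (zf t - u t) < s / 8.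
  move=> t0 t1; rewrite -(ltr_pM2l K0); have := zu t t0 t1; lra.
have slope t : 0 <= t -> t <= 1 -> dot ((2 * K) *: (u t - zf t)) w < r.
  move=> t0 t1; rewrite ltNge; apply/negP => le_r; apply: no.
  have [cz zmin] := zfP t t0 t1; have zst := zs t t0 t1; have zut := zu t t0 t1.
  exists (zf t), ((2 * K) *: (u t - zf t)); split => //.
  - have := ler_enorm_dist (u t) (zf t) c; have := uc t t0 t1; lra.
  - exists K, (s / 8); split; [by [] | by lra |] => z' z'z.
    have := zmin z'; rewrite /cball.
    have -> : enorm (z' - u t) <= s / 4.
      have := ler_enorm_dist (zf t) z' (u t); lra.
    move=> /(_ isT); rewrite /h.
    have -> : z' - u t = (z' - zf t) - (u t - zf t) by rewrite opprB addrA subrK.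
    rewrite (enormB (zf t)); move: (u t - zf t) (z' - zf t) => a b.
    by rewrite -!dot_enorm !dotE (dotC b a); lra.
  - rewrite enormZ gtr0_norm ?mulr_gt0 // enormB; lra.
(* If all slopes are below [r], the envelope minus [t * r] has increments that are at most
   quadratic, so it does not increase. *)
have : h 1 (zf 1) - 1 * r <= h 0 (zf 0) - 0 * r.
  apply: (@le_of_quadratic_increments (fun t => h t (zf t) - t * r) (K * enorm w ^+ 2)).
  move=> t d t0 d0 td1.
  have t1 : t <= 1 by lra.
  have [_ +] := zfP (t + d) (addr_ge0 t0 d0) td1 => /(_ (zf t)).
  have utd : u (t + d) = u t + d *: w by rewrite /u scalerDl addrA.
  have dw : d * enorm w <= enorm w by rewrite ler_piMl ?enorm_ge0 //; lra.
  (* The old minimizer [zf t] competes at [t + d]: it lies within [s / 8 + s / 8] of the new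
     centre. *)
  rewrite /cball {1}utd; have -> : enorm (zf t - (u t + d *: w)) <= s / 4.
    have := ler_enormD (zf t - u t) (- (d *: w)); rewrite enormN enormZ ger0_norm //.
    by rewrite -addrA -opprD; have := zs t t0 t1; lra.
  move=> /(_ isT) hle.
  have : h (t + d) (zf t) = h t (zf t) + d * dot ((2 * K) *: (u t - zf t)) w + K * enorm w ^+ 2 * d ^+ 2.
    rewrite /h utd; have -> : zf t - (u t + d *: w) = - ((u t - zf t) + d *: w).
      by rewrite [RHS]opprD opprB opprD addrA.
    rewrite (enormB (zf t)) enormN; move: (u t - zf t) => a.
    by rewrite -!dot_enorm !dotE (dotC w a); ring.
  have := ler_wpM2l d0 (ltW (slope t t0 t1)); lra.
(* At the endpoints the envelope is at most [f p] and at least [f (p + w) - L ^+ 2 / K],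
   contradicting the size of [gap]. *)
have [_ /(_ (u 0))] := zfP 0 (lexx 0) ler01.
have [c1 _] := zfP 1 ler01 (lexx 1).
rewrite {1}/cball subrr enorm0 => /(_ (ltW (divr_gt0 s0 (ltr0Sn _ _)))).
rewrite /h subrr enorm0 /u scale0r scale1r addr0 => h0.
have := zu 1 ler01 (lexx 1); have := zs 1 ler01 (lexx 1).
rewrite /u scale1r => z1s z1u; have := uc 1 ler01 (lexx 1); rewrite /u scale1r => u1c.
have := fL (p + w) (zf 1); have -> : enorm (p + w - c) < s by lra.
have -> : enorm (zf 1 - c) < s by have := ler_enorm_dist (p + w) (zf 1) c; lra.
move=> /(_ isT isT); rewrite (enormB (p + w)) => fz.
have ? := enorm_ge0 (zf 1 - (p + w)).
have : K * (L * enorm (zf 1 - (p + w))) <= L ^+ 2 by nra.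
rewrite /gap in gapL; nra.
Qed.

End MeanValue.

(** * From tilt stability to strong monotonicity of the gradient *)

Section TiltStability.
Variables (R : realType) (n : nat).

(** A short step t in the direction [e = v - g], with both errors at rate |e| / 4, would give t
    |e|^2 <= t |e|^2 / 2. *)
Lemma regular_subgrad_is_grad (phi : 'rV[R]_n -> R) (x g v : 'rV[R]_n) :
  is_grad phi x g ->
  (forall eps : R, 0 < eps -> exists2 d : R, 0 < d &
    forall y, enorm (y - x) < d ->
      phi x + dot v (y - x) - eps * enorm (y - x) <= phi y) ->
  v = g.
Proof.
move=> gradg subv; apply/eqP; rewrite -subr_eq0; apply/eqP/enorm_eq0.
set e := v - g; apply/eqP; apply: contrapT => /negP e_neq0.
have e0 : 0 < enorm e by rewrite lt_def e_neq0 enorm_ge0.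
have e4 : 0 < enorm e / 4 by lra.
have [d d0 gd] := gradg _ e4; have [d' d'0 vd] := subv _ e4.
pose t := Num.min d d' / (2 * enorm e).
have m0 : 0 < Num.min d d' by rewrite lt_min d0.
have t0 : 0 < t by rewrite divr_gt0 // mulr_gt0.
have te : t * enorm e = Num.min d d' / 2 by rewrite /t; field; rewrite gt_eqF.
have yx : x + t *: e - x = t *: e by rewrite addrC addKr.
have nyx : enorm (t *: e) = t * enorm e by rewrite enormZ gtr0_norm.
have := gd (x + t *: e); have := vd (x + t *: e); rewrite yx nyx te.
have -> : Num.min d d' / 2 < d by have : Num.min d d' <= d by [rewrite ge_min lexx]; lra.
have -> : Num.min d d' / 2 < d' by have : Num.min d d' <= d' by [rewrite ge_min lexx orbT]; lra.
move=> /(_ isT) h1 /(_ isT); rewrite ler_norml => /andP[_]; move: h1.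
rewrite -te !dotZr.
have : dot v e - dot g e = enorm e ^+ 2 by rewrite -dot_enorm -dotNl -dotDl.
by move: (dot v e) (dot g e) => a b; nra.
Qed.

(** Here [m] is a Lipschitz selection of subgradients of [psi]; the bound comes from summing it
    along the segment, without differentiating [psi]. *)
Lemma descent_inequality (psi : 'rV[R]_n -> R) (m : 'rV[R]_n -> 'rV[R]_n) (eps kappa : R)
    (v h : 'rV[R]_n) :
  (forall v v', enorm v < eps -> enorm v' < eps ->
    psi v + dot (v' - v) (m v) <= psi v') ->
  (forall v v', enorm v < eps -> enorm v' < eps ->
    enorm (m v - m v') <= kappa * enorm (v - v')) ->
  enorm v < eps -> enorm (v + h) < eps ->
  psi (v + h) <= psi v + dot h (m v) + kappa / 2 * enorm h ^+ 2.
Proof.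
move=> sub lip ve vhe.
have seg s : 0 <= s -> s <= 1 -> enorm (v + s *: h) < eps.
  move=> s0 s1; have -> : v + s *: h = (1 - s) *: v + s *: (v + h).
    by rewrite scalerBl scale1r scalerDr addrA subrK.
  apply: le_lt_trans (ler_enormD _ _) _; rewrite !enormZ !ger0_norm //; last by lra.
  by have [->|] := eqVneq s 0; [lra | move=> sn; have : 0 < s by [rewrite lt_def sn]; nra].
(* The subgradient inequality at the later point b bounds each increment of [psi] by t <h, m b>, and
   the Lipschitz bound compares m b with [m v]. Subtracting the quadratic term leaves exactly kappa
   / 2 |h|^2 t^2. *)
have : psi (v + 1 *: h) - 1 * dot h (m v) - kappa / 2 * enorm h ^+ 2 * 1 ^+ 2
    <= psi (v + 0 *: h) - 0 * dot h (m v) - kappa / 2 * enorm h ^+ 2 * 0 ^+ 2.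
  apply: (@le_of_quadratic_increments _
    (fun s => psi (v + s *: h) - s * dot h (m v) - kappa / 2 * enorm h ^+ 2 * s ^+ 2)
    (kappa / 2 * enorm h ^+ 2)).
  move=> s t s0 t0 st1; have st0 : 0 <= s + t by lra.
  have s1 : s <= 1 by lra.
  have a_eps := seg s s0 s1; have b_eps := seg (s + t) st0 st1.
  have := sub _ _ b_eps a_eps.
  have -> : v + s *: h - (v + (s + t) *: h) = - (t *: h).
    by rewrite opprD addrACA subrr add0r scalerDl opprD addNKr.
  have := lip _ _ b_eps ve; rewrite [v + _]addrC addrK enormZ ger0_norm // addrC.
  set b := v + (s + t) *: h => lb.
  have := dot_le h (m b - m v); rewrite !dotE => hb.
  have h0 := enorm_ge0 h.
  have : dot h (m b) - dot h (m v) <= kappa * (s + t) * enorm h ^+ 2.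
    by have := ler_wpM2l h0 lb; lra.
  by move=> /(ler_wpM2l t0); lra.
by rewrite scale1r scale0r addr0; lra.
Qed.

(* Baillon-Haddad: the descent inequality at v2 in the direction
   - kappa^-1 (m v2 - m v1), against the subgradient inequality at v1. *)
Lemma cocoercive_half (psi : 'rV[R]_n -> R) (m : 'rV[R]_n -> 'rV[R]_n) (eps kappa : R)
    (v1 v2 : 'rV[R]_n) :
  0 < kappa ->
  (forall v v', enorm v < eps -> enorm v' < eps ->
    psi v + dot (v' - v) (m v) <= psi v') ->
  (forall v v', enorm v < eps -> enorm v' < eps ->
    enorm (m v - m v') <= kappa * enorm (v - v')) ->
  enorm v1 < eps / 3 -> enorm v2 < eps / 3 ->
  psi v1 + dot (v2 - v1) (m v1) + kappa^-1 / 2 * enorm (m v2 - m v1) ^+ 2 <= psi v2.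
Proof.
move=> k0 sub lip v1e v2e.
have v1e' : enorm v1 < eps by have := enorm_ge0 v1; lra.
have v2e' : enorm v2 < eps by have := enorm_ge0 v2; lra.
pose h := - kappa^-1 *: (m v2 - m v1).
have kk : kappa * kappa^-1 = 1 by rewrite divff ?gt_eqF.
have ki : 0 < kappa^-1 by rewrite invr_gt0.
(* This bound keeps [v2 + h] within [eps], the reason for the radius [eps / 3]. *)
have hv : enorm h <= enorm (v2 - v1).
  rewrite enormZ normrN gtr0_norm // mulrC ler_pdivrMr // mulrC.
  exact: lip.
have v2h : enorm (v2 + h) < eps.
  have := ler_enormD v2 h; have := ler_enormD v2 (- v1); rewrite enormN; lra.
have := descent_inequality sub lip v2e' v2h; have := sub _ _ v1e' v2h.
rewrite -!dot_enorm /h; move: (m v1) (m v2) => a b.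
rewrite !dotE (dotC a b).
have -> : kappa / 2 * (- kappa^-1 * (- kappa^-1 * (dot b b - dot b a) - - kappa^-1 * (dot b a - dot a a)))
  = kappa^-1 / 2 * (kappa * kappa^-1) * (dot b b - dot b a - (dot b a - dot a a)) by ring.
by rewrite kk mulr1; lra.
Qed.

(** The half inequalities for (v1, v2) and (v2, v1) are added; the values of [psi] cancel. *)
Lemma cocoercive (psi : 'rV[R]_n -> R) (m : 'rV[R]_n -> 'rV[R]_n) (eps kappa : R)
    (v1 v2 : 'rV[R]_n) :
  0 < kappa ->
  (forall v v', enorm v < eps -> enorm v' < eps ->
    psi v + dot (v' - v) (m v) <= psi v') ->
  (forall v v', enorm v < eps -> enorm v' < eps ->
    enorm (m v - m v') <= kappa * enorm (v - v')) ->
  enorm v1 < eps / 3 -> enorm v2 < eps / 3 ->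
  enorm (m v1 - m v2) ^+ 2 <= kappa * dot (v1 - v2) (m v1 - m v2).
Proof.
move=> k0 sub lip v1e v2e.
have := cocoercive_half k0 sub lip v1e v2e; have := cocoercive_half k0 sub lip v2e v1e.
rewrite (enormB (m v2)) -ler_pdivrMl // !dotE; lra.
Qed.

(* A small ball around xbar lies in the image of the argmin map m: the point x
   is m v for the minimizer v of psi - <., x>, where psi(v) = <v, m v> - phi(m v)
   is the conjugate of phi. The minimizer is interior because, phi being
   differentiable with zero gradient at xbar, psi - <., xbar> grows away from 0. *)
Lemma tilt_argmin_onto (phi : 'rV[R]_n -> R) (grad m : 'rV[R]_n -> 'rV[R]_n)
    (xbar : 'rV[R]_n) (kappa r gamma eps : R) :
  0 < kappa -> 0 < r -> 0 < gamma -> 0 < eps ->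
  (forall x, enorm (x - xbar) < r -> is_grad phi x (grad x)) ->
  grad xbar = 0 -> m 0 = xbar ->
  (forall v, enorm v < eps -> forall x, Mtilt phi xbar gamma v x <-> x = m v) ->
  (forall v v', enorm v < eps -> enorm v' < eps ->
    enorm (m v - m v') <= kappa * enorm (v - v')) ->
  forall e, 0 < e -> e < eps -> exists2 rho, 0 < rho &
    forall x, enorm (x - xbar) < rho -> enorm (grad x) < e /\ m (grad x) = x.
Proof.
move=> k0 r0 g0 eps0 gradP grad0 m0 mP lip e e0 e_eps.
pose psi v := dot v (m v) - phi (m v).
have mM v : enorm v < eps -> Mtilt phi xbar gamma v (m v) by move=> ve; exact/mP.
have psi_ge v x : enorm v < eps -> cball xbar gamma x -> dot v x - phi x <= psi v.
  by move=> /mM[_ h] /h; rewrite /psi; lra.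
have sub v v' : enorm v < eps -> enorm v' < eps ->
    psi v + dot (v' - v) (m v) <= psi v'.
  by move=> /mM[c _] /psi_ge/(_ c); rewrite /psi dotDl dotNl; lra.
have eps00 : enorm (0 : 'rV[R]_n) < eps by rewrite enorm0.
have e2 : 0 < e / 2 by lra.
have [|d d0 gd] := gradP xbar _ _ e2; first by rewrite subrr enorm0.
rewrite grad0 in gd.
pose a := Num.min d gamma.
have a0 : 0 < a by rewrite lt_min d0.
have [ad ag] : a <= d /\ a <= gamma by rewrite !ge_min !lexx orbT.
clearbody a.
exists (Num.min r (a / 4)); first by rewrite lt_min r0 divr_gt0.
move=> x; rewrite lt_min => /andP[xr xa].
pose F v := psi v - dot v x.
(* By [sub], [m y - x] is a subgradient of [F] at [y]; its norm stays below [kappa * e + a]. *)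
have [|||v ve vmin] := @lipschitz_has_min R n F 0 e (kappa * e + a).
- exact: ltW.
- by rewrite addr_ge0 ?mulr_ge0 ?ltW.
- move=> y z; rewrite /cball !subr0 => ye ze.
  have ye' : enorm y < eps by lra.
  have ze' : enorm z < eps by lra.
  have := sub y z ye' ze'; have := dot_le (y - z) (m y - x).
  have := lip _ _ ye' eps00; rewrite m0 subr0 => my.
  have := ler_enorm_dist xbar (m y) x; rewrite (enormB xbar) => myx.
  have : enorm (m y - x) <= kappa * e + a.
    have := ler_wpM2l (ltW k0) ye; lra.
  move=> /(ler_wpM2l (enorm_ge0 (y - z))).
  by rewrite /F !dotE; lra.
move: ve; rewrite /cball subr0 => ve.
have ve_eps : enorm v < eps by lra.
(* If |v| = e, testing [psi v] at [xbar + s *: v], at distance a / 2 from [xbar], gains e a / 2 and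
   loses at most e a / 4 to differentiability. As |x - xbar| < a / 4, [F v] would exceed [F 0]. *)
have v_lt : enorm v < e.
  rewrite lt_def ve andbT; apply/negP => /eqP ve'.
  pose s := a / (2 * e).
  have se : s * e = a / 2 by rewrite /s; field; rewrite gt_eqF.
  have s0 : 0 < s by rewrite divr_gt0 // mulr_gt0.
  have nsv : enorm (s *: v) = a / 2 by rewrite enormZ gtr0_norm // -ve' se.
  have := psi_ge v (xbar + s *: v) ve_eps; rewrite /cball addrAC subrr add0r nsv.
  have -> : a / 2 <= gamma by lra.
  move=> /(_ isT); have := gd (xbar + s *: v); rewrite addrAC subrr add0r nsv dot0l.
  have -> : a / 2 < d by lra.
  move=> /(_ isT); rewrite subr0 ler_norml => /andP[_ phis].
  have := vmin 0; rewrite /cball subr0 enorm0 => /(_ (ltW e0)).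
  rewrite /F /psi m0 !dot0l -/(psi v) !dotE dot_enorm -ve'.
  have := dot_ge v (xbar - x); rewrite enormB -ve' !dotE.
  have : s * e ^+ 2 = a / 2 * e by rewrite -se; ring.
  nra.
have mv : m v = x.
  apply/eqP; rewrite eq_sym -subr_eq0; apply/eqP/enorm_eq0; set z := x - m v.
  apply/eqP; apply: contrapT => /negP z_neq0.
  have z0 : 0 < enorm z by rewrite lt_def z_neq0 enorm_ge0.
  (* The first bound keeps [v + t *: z] in the ball where [v] is minimal; the second makes
     [t * kappa] at most 1 / 2, while minimality forces |z|^2 <= kappa t |z|^2. *)
  pose t := Num.min ((e - enorm v) / enorm z) (kappa^-1 / 2).
  have t0 : 0 < t by rewrite lt_min !divr_gt0 ?invr_gt0 // subr_gt0.
  have tz : t * enorm z <= e - enorm v by rewrite -ler_pdivlMr // ge_min lexx.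
  have tk : t * kappa <= 1 / 2.
    rewrite -ler_pdivlMr // ge_min; apply/orP; right.
    by rewrite mul1r mulrC.
  clearbody t.
  have ntz : enorm (t *: z) = t * enorm z by rewrite enormZ gtr0_norm.
  have vtz : enorm (v + t *: z) <= e by have := ler_enormD v (t *: z); lra.
  have vtz_eps : enorm (v + t *: z) < eps by lra.
  have := vmin (v + t *: z); rewrite /cball subr0 => /(_ vtz).
  have := sub _ _ vtz_eps ve_eps.
  have := lip _ _ vtz_eps ve_eps; rewrite addrAC subrr add0r ntz.
  have -> : v - (v + t *: z) = - (t *: z) by rewrite opprD addrA subrr add0r.
  have := dot_le z (m (v + t *: z) - m v).
  have zE : dot z z = dot z x - dot z (m v) by rewrite {2}/z dotDr dotNr.
  rewrite dot_enorm in zE; clearbody z.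
  rewrite /F !dotE; move: (psi (v + _)) (psi v) => p1 p2.
  move=> h1 h2 h3 h4.
  have : enorm z ^+ 2 <= enorm z * (kappa * (t * enorm z)).
    have h5 := ler_wpM2l (enorm_ge0 z) h2.
    suff : t * enorm z ^+ 2 <= t * (enorm z * (kappa * (t * enorm z))).
      by rewrite ler_pM2l.
    have := ler_wpM2l (ltW t0) (le_trans h1 h5). rewrite zE; lra.
  have : 0 < enorm z ^+ 2 by rewrite exprn_gt0.
  nra.
(* Since [x = m v] is interior to the [gamma] ball, minimality makes [v] a regular subgradient of
   [phi] at [x]. *)
suff <- : v = grad x by [].
apply: (regular_subgrad_is_grad (gradP x xr)) => eta eta0.
exists (a / 2); first by lra.
move=> y yx; have [_ xmin] := mM v ve_eps; rewrite mv in xmin.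
have := xmin y; rewrite /cball; have -> : enorm (y - xbar) <= gamma.
  have := ler_enorm_dist x y xbar; lra.
move=> /(_ isT); rewrite !dotE.
have := mulr_ge0 (ltW eta0) (enorm_ge0 (y - x)); lra.
Qed.

(** Cocoercivity of [m] is evaluated at [grad x] and [grad y], which [m] sends back to [x] and
    [y]. *)
Lemma tilt_strongly_monotone (phi : 'rV[R]_n -> R) (grad : 'rV[R]_n -> 'rV[R]_n)
    (xbar : 'rV[R]_n) (kappa r : R) :
  0 < kappa -> 0 < r ->
  (forall x, enorm (x - xbar) < r -> is_grad phi x (grad x)) ->
  tilt_stable phi xbar kappa ->
  grad xbar = 0 /\ exists2 rho, 0 < rho &
    forall x y, enorm (x - xbar) < rho -> enorm (y - xbar) < rho ->
      enorm (x - y) ^+ 2 <= kappa * dot (grad x - grad y) (x - y).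
Proof.
move=> k0 r0 gradP [gamma [g0 [eps [eps0 [m [mP [lip bP]]]]]]].
have m0 : m 0 = xbar.
  by apply/esym/mP; [rewrite enorm0 | exact/bP].
have grad0 : grad xbar = 0.
  have [|_ xmin] := (bP xbar).2 _; first by [].
  apply/esym/(@regular_subgrad_is_grad phi xbar); first by apply: gradP; rewrite subrr enorm0.
  move=> e e0; exists gamma => // y /ltW/xmin; rewrite !dot0l.
  have := mulr_ge0 (ltW e0) (enorm_ge0 (y - xbar)); lra.
split=> //.
have eps3 : 0 < eps / 3 by lra.
have eps3' : eps / 3 < eps by lra.
have [rho rho0 onto] := tilt_argmin_onto k0 r0 g0 eps0 gradP grad0 m0 mP lip eps3 eps3'.
exists rho => // x y /onto[gx mx] /onto[gy my].
have := @cocoercive (fun v => dot v (m v) - phi (m v)) m eps kappa (grad x) (grad y) k0 _ lip gx gy.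
rewrite mx my; apply=> v v' /mP/(_ (m v))/iffRL/(_ erefl)[c _].
move=> /mP/(_ (m v'))/iffRL/(_ erefl)[_ /(_ _ c)].
by rewrite dotDl dotNl; lra.
Qed.

End TiltStability.

(** * Normals to graphs and coderivatives *)

Section Coderivative.
Variables (R : realType) (n : nat).
Implicit Types (G : 'rV[R]_n * 'rV[R]_n -> Prop) (g : 'rV[R]_n -> 'rV[R]_n).

Lemma is_grad_unique (phi : 'rV[R]_n -> R) (x g g' : 'rV[R]_n) :
  is_grad phi x g -> is_grad phi x g' -> g = g'.
Proof.
move=> xg /regular_subgrad_is_grad; apply => e e0.
have [d d0 gd] := xg e e0; exists d => // y /gd.
by rewrite ler_norml => /andP[+ _]; lra.
Qed.

Lemma pconv_of_le_harmonic (s : nat -> 'rV[R]_n * 'rV[R]_n) l (C : R) :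
  0 < C -> (forall k, pnorm (psub (s k) l) <= C * k.+1%:R^-1) -> pconv s l.
Proof.
move=> C0 sC e e0; exists (Num.bound (C / e)) => k Nk.
apply: le_lt_trans (sC k) _; rewrite ltr_pdivrMr ?ltr0n // mulrC -ltr_pdivrMr //.
apply: lt_le_trans (archi_boundP _) _; first by rewrite divr_ge0 ?ltW.
by rewrite ler_nat (leq_trans Nk).
Qed.

(** The quadratic error K |p1 - z|^2 is at most e |p1 - z| once |p1 - z| < e / K. *)
Lemma prox_subgrad_reg_normal G g (x z d y : 'rV[R]_n) (s : R) :
  (forall z z', enorm (z - x) < s -> (G (z, z') <-> z' = g z)) ->
  enorm (z - x) < s -> prox_subgrad (fun z => dot d (g z)) z y ->
  reg_normal G (z, g z) (y, - d).
Proof.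
move=> Gg zx [K [t [K0 t0 prox]]]; split; first exact/Gg.
move=> e e0; exists (Num.min t (Num.min (s - enorm (z - x)) (e / K))).
  by rewrite !lt_min t0 subr_gt0 zx divr_gt0.
case=> p1 p2 Gp pz; have := le_lt_trans (pnorm_fst _) pz; rewrite /= !lt_min.
move=> /and3P[pt ps pe].
have px : enorm (p1 - x) < s by have := ler_enorm_dist z p1 x; lra.
rewrite ((Gg _ _ px).1 Gp) in pz *.
apply: (@le_trans _ _ (e * enorm (p1 - z))); last first.
  by rewrite ler_pM2l // (pnorm_fst (psub (p1, g p1) (z, g z))).
have := prox _ pt; rewrite /pdot /= !dotE.
move: pe; rewrite ltr_pdivlMr // => pe.
have := ler_wpM2l (enorm_ge0 (p1 - z)) (ltW pe); lra.
Qed.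

(* The sign of a regular normal (b, a) is exploitable only for a backward step
   from its base point x_k, hence the segment [x_k - t w, x_k]. *)
Lemma lim_normal_steep_segment G g (x v q u d : 'rV[R]_n) (kappa L s s0 eta : R) :
  0 < kappa -> 0 < L -> 0 < s -> s <= s0 -> 0 < eta ->
  (forall z z', enorm (z - x) < s0 -> (G (z, z') <-> z' = g z)) ->
  (forall y z, enorm (y - x) < s0 -> enorm (z - x) < s0 ->
    enorm (g y - g z) <= L * enorm (y - z)) ->
  (forall y z, enorm (y - x) < s0 -> enorm (z - x) < s0 ->
    enorm (y - z) ^+ 2 <= kappa * dot (g y - g z) (y - z)) ->
  lim_normal (gph_inv G) (v, x) (q, - u) ->
  exists p t, [/\ 0 < t, enorm (p - x) <= s / 4, t * enorm (d - q) <= s / 8 &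
    t * (dot u (d - q) + enorm (d - q) ^+ 2 / kappa - eta) <
      dot d (g (p + t *: (d - q))) - dot d (g p)].
Proof.
move=> k0 L0 sp ss0 eta0 Gg lip mono [_ [ps [ws [psx [wsq [Gps regn]]]]]].
set w := d - q; have dE : d = q + w by rewrite /w addrC subrK.
clearbody w; pose W := enorm w; have W0 : 0 <= W := enorm_ge0 w.
(* The normal inequality and the replacement of its normal by [(q, - u)] cost at most 2 e (1 + L) t
   W in total, below [t * eta]; the 1 in [W + 1] covers [w = 0]. *)
pose e := eta / (2 * (1 + L) * (W + 1)).
have den0 : 0 < 2 * (1 + L) * (W + 1) by rewrite !mulr_gt0 ?ltr_wpDl ?ler01 // ltr_wpDl.
have e0 : 0 < e by rewrite divr_gt0.
have eE : e * (2 * (1 + L) * (W + 1)) = eta by rewrite divfK // gt_eqF.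
clearbody e.
have s8 : 0 < s / 8 by lra.
have [N1 psN] := psx _ s8; have [N2 wsN] := wsq _ e0.
pose k := maxn N1 N2.
have {psN}psk := psN k (leq_maxl _ _); have {wsN}wsk := wsN k (leq_maxr _ _).
have := Gps k; have [_ {regn}regk] := regn k.
case: (ps k) psk regk => vk xk /(le_lt_trans (pnorm_snd _)) /= xkx regk.
case: (ws k) wsk regk => b a wsk regk.
have bq := le_lt_trans (pnorm_fst _) wsk; have av := le_lt_trans (pnorm_snd _) wsk.
rewrite /= opprK in bq av => {wsk}.
rewrite /gph_inv /= => Gk.
have xks : enorm (xk - x) < s0 by lra.
have vkE := (Gg _ _ xks).1 Gk; rewrite {}vkE in regk.
have [d0 d00 {}regk] := regk e e0.
(* The step has length below [s / 8], and the graph point moves by at most (1 + L) t W < d0, within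
   reach of the normal inequality. *)
pose t := Num.min (s / 8) (d0 / (1 + L)) / (W + 1).
have L10 : 0 < 1 + L by lra.
have W10 : 0 < W + 1 by lra.
have m0 : 0 < Num.min (s / 8) (d0 / (1 + L)) by rewrite lt_min s8 divr_gt0.
have t0 : 0 < t by rewrite divr_gt0.
have tW : t * (W + 1) = Num.min (s / 8) (d0 / (1 + L)) by rewrite divfK // gt_eqF.
have tWs : t * W < s / 8.
  have : t * (W + 1) <= s / 8 by rewrite tW ge_min lexx.
  lra.
have tWd : (1 + L) * (t * W) < d0.
  have : t * (W + 1) <= d0 / (1 + L) by rewrite tW ge_min lexx orbT.
  by rewrite ler_pdivlMr //; nra.
clearbody t.
pose p := xk - t *: w.
have ntw : enorm (t *: w) = t * W by rewrite enormZ gtr0_norm.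
have px : enorm (p - x) <= s / 4.
  by have := ler_enormD (xk - x) (- (t *: w)); rewrite addrAC -/p enormN ntw; lra.
have ps0 : enorm (p - x) < s0 by lra.
exists p, t; split=> //; first exact: ltW.
rewrite subrK.
have pxk : p - xk = - (t *: w) by rewrite /p addrAC subrr add0r.
have xkp : xk - p = t *: w by rewrite -opprB pxk opprK.
have lp := lip _ _ ps0 xks; rewrite pxk enormN ntw in lp.
have := mono _ _ xks ps0; rewrite xkp ntw dotZr exprMn => mp.
have dn : pnorm (psub (g p, p) (g xk, xk)) <= (1 + L) * (t * W).
  by apply: le_trans (pnorm_le _) _; rewrite /= pxk enormN ntw; lra.
(* As [p - xk] is [- (t *: w)] and the normal is close to [(q, - u)], this bounds <q, g xk - g p>
   below by nearly t <u, w>. Strong monotonicity bounds <w, g xk - g p>, and d = q + w. *)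
have {regk} := regk (g p, p); rewrite /gph_inv /= => /(_ ((Gg _ _ ps0).2 erefl)).
move=> /(_ (le_lt_trans dn tWd)); rewrite /pdot /= pxk => regk.
have {regk dn} := le_trans regk (ler_wpM2l (ltW e0) dn).
have := dot_le (q - b) (g p - g xk).
have := ler_pM (enorm_ge0 (q - b)) (enorm_ge0 (g p - g xk)) (ltW _) lp.
rewrite enormB => /(_ _ bq).
have := dot_le (a + u) w.
have := ler_wpM2r W0 (ltW av).
have : t * (W ^+ 2 / kappa) <= dot (g xk - g p) w.
  rewrite mulrA ler_pdivrMr // -(ler_pM2l t0); lra.
rewrite dE -/W !dotE (dotC (g xk)) (dotC (g p)).
move=> h1 h2 h3 h4 h5 h6.
have h7 : e * (2 * (1 + L) * W) < eta by rewrite -eE ltr_pM2l // ltr_pM2l ?mulr_gt0 //; lra.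
have := ler_wpM2l (ltW t0) (le_trans h3 h2).
have : t * (e * (2 * (1 + L) * W)) < t * eta by rewrite ltr_pM2l.
lra.
Qed.

(** Steep segments at ever smaller scales yield proximal subgradients of <d, g> bounded by [2 * Lf];
    a cluster point inherits the slope bound. [G] need only be the graph of [g] near [x]. *)
Lemma monotone_coderiv_exists G g (x v q u d : 'rV[R]_n) (kappa L s : R) :
  0 < kappa -> 0 < L -> 0 < s ->
  (forall z z', enorm (z - x) < s -> (G (z, z') <-> z' = g z)) ->
  (forall y z, enorm (y - x) < s -> enorm (z - x) < s ->
    enorm (g y - g z) <= L * enorm (y - z)) ->
  (forall y z, enorm (y - x) < s -> enorm (z - x) < s ->
    enorm (y - z) ^+ 2 <= kappa * dot (g y - g z) (y - z)) ->
  coderiv (gph_inv G) v x u q ->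
  exists2 y, coderiv G x v d y &
    enorm (d - q) ^+ 2 <= kappa * dot (y - u) (d - q).
Proof.
move=> k0 L0 s0 Gg lip mono qu; have Gxv : G (x, v) := qu.1.
have xs : enorm (x - x) < s by rewrite subrr enorm0.
have vE := (Gg _ _ xs).1 Gxv.
set w := d - q; pose T := dot u w + enorm w ^+ 2 / kappa.
pose f z := dot d (g z); pose Lf := (enorm d + 1) * L.
have d1 : 0 < enorm d + 1 by have := enorm_ge0 d; lra.
have Lf0 : 0 < Lf by rewrite mulr_gt0.
have fL y z : enorm (y - x) < s -> enorm (z - x) < s -> f y - f z <= Lf * enorm (y - z).
  move=> ys zs; have := ler_wpM2l (enorm_ge0 d) (lip y z ys zs).
  have := dot_le d (g y - g z); have := mulr_ge0 (ltW L0) (enorm_ge0 (y - z)).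
  by rewrite /f /Lf !dotE; lra.
(* Distance below [s] is imposed separately because [e] may exceed [s], beyond which [g] is not
   controlled. *)
pose F (e : R) y := exists z, [/\ enorm (z - x) < e, enorm (z - x) < s,
  prox_subgrad f z y, enorm y <= 2 * Lf & T - e <= dot y w].
have [e e0|e y _ [z [_ _ _ //]]|e e' y ee' [z [ze zs zy yL Ty]]|y yF] :=
  @bounded_cluster R n F (2 * Lf).
- pose r := Num.min s e.
  have r0 : 0 < r by rewrite lt_min s0.
  have [rs re] : r <= s /\ r <= e by rewrite !ge_min !lexx orbT.
  have [p [t [t0 pr tr slope]]] :=
    lim_normal_steep_segment d k0 L0 r0 rs e0 Gg lip mono qu.
  have [||z [y [zr zy yL ty]]] := @prox_mean_value R n f x p (t *: w) r Lf _ r0 Lf0 _ pr _ slope.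
  + by move=> y z yr zr; apply: fL; apply: lt_le_trans rs.
  + by rewrite enormZ gtr0_norm.
  exists y, z; split=> //; try exact: lt_le_trans zr _.
  by rewrite dotZr ler_pM2l in ty.
- by exists z; split=> //; [exact: lt_le_trans ee' | lra].
have /choice[yz yzP] k : exists yz : 'rV[R]_n * 'rV[R]_n,
    [/\ enorm (yz.1 - y) < k.+1%:R^-1, enorm (yz.2 - x) < k.+1%:R^-1,
    enorm (yz.2 - x) < s & prox_subgrad f yz.2 yz.1].
  have k1 : 0 < k.+1%:R^-1 :> R by rewrite invr_gt0 ltr0n.
  by have [y' [z [? ? ? _ _]] yy'] := yF _ k1; exists (y', z).
exists y.
  split=> //; exists (fun k => ((yz k).2, g (yz k).2)), (fun k => ((yz k).1, - d)).
  split; [|split; [|split]].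
  - apply: (@pconv_of_le_harmonic _ _ (1 + L)); first by lra.
    move=> k; have [_ zx zs _] := yzP k; apply: le_trans (pnorm_le _) _.
    have := lip _ _ zs xs; rewrite /= vE mulrDl mul1r => gzx.
    by apply: lerD (ltW zx) (le_trans gzx _); rewrite ler_wpM2l ?ltW.
  - apply: (@pconv_of_le_harmonic _ _ 1) => // k; have [yk _ _ _] := yzP k.
    by apply: le_trans (pnorm_le _) _; rewrite /= subrr enorm0 addr0 mul1r ltW.
  - by move=> k; have [_ _ zs _] := yzP k; exact/Gg.
  - by move=> k; have [_ _ zs zy] := yzP k; exact: prox_subgrad_reg_normal zs zy.
clearbody w; have W0 := enorm_ge0 w; have W1 : 0 < 1 + enorm w by lra.
rewrite -ler_pdivrMl // mulrC dotDl dotNl; apply/ler_addgt0Pr => e e0.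
have [y' [z [_ _ _ _ Ty']] y'y] := yF _ (divr_gt0 e0 W1).
have := dot_le (y' - y) w; rewrite !dotE => h.
have h' := ler_wpM2r W0 (ltW y'y).
have : e / (1 + enorm w) * (1 + enorm w) = e by rewrite divfK // gt_eqF.
by move: Ty'; rewrite /T; lra.
Qed.

End Coderivative.

Theorem theorem3p1 (R : realType) (n : nat) (phi : 'rV[R]_n -> R)
    (grad : 'rV[R]_n -> 'rV[R]_n) (xbar : 'rV[R]_n) (kappa : R) :
  0 < kappa ->
  C11_near phi grad xbar ->
  tilt_stable phi xbar kappa ->
  let vbar : 'rV[R]_n := 0 in
  exists2 delta : R, 0 < delta &
    forall x v q : 'rV[R]_n,
      gph_grad phi (x, v) ->
      pnorm (psub (x, v) (xbar, vbar)) <= delta ->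
      coderiv (gph_inv (gph_grad phi)) v x (v - vbar) q ->
      exists y : 'rV[R]_n,
        coderiv (gph_grad phi) x v (x - xbar) y /\
        enorm (x - xbar - q) <= kappa * enorm (grad x - grad xbar - y).
Proof.
move=> k0 [r r0 [gradP locLip]] tilt vbar.
have [grad0 [rho rho0 mono]] := tilt_strongly_monotone k0 r0 gradP tilt.
pose r' := Num.min r rho.
have r'0 : 0 < r' by rewrite lt_min r0.
have [r'r r'rho] : r' <= r /\ r' <= rho by rewrite !ge_min !lexx orbT.
(* Points within r' / 2 of such an [x] remain within [r'] of [xbar]. *)
exists (r' / 2); first by lra.
move=> x v q xv /(le_trans (pnorm_fst _)) /= xx qv.
have xr : enorm (x - xbar) < r by lra.
have vE := is_grad_unique xv (gradP x xr).
have [s [L [s0 lip]]] := locLip x xr.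
pose s' := Num.min s (r' / 2).
have s'0 : 0 < s' by rewrite lt_min s0 divr_gt0.
have [s's s'r] : s' <= s /\ s' <= r' / 2 by rewrite !ge_min !lexx orbT.
have near z : enorm (z - x) < s' -> [/\ enorm (z - x) < s, enorm (z - xbar) < r & enorm (z - xbar) < rho].
  by move=> zs; have := ler_enorm_dist x z xbar; split; lra.
(* The local constant [L] may have any sign, whereas a positive one is required. *)
have L1 : 0 < `|L| + 1 by rewrite ltr_wpDl.
have [z z' /near[_ zr _]|y z /near[ys yr _] /near[zs zr _]|y z /near[_ _ yr] /near[_ _ zr]|y ycod wy] :=
  @monotone_coderiv_exists R n (gph_grad phi) grad x v q (v - vbar) (x - xbar) kappa (`|L| + 1) s' k0 L1 s'0 _ _ _ qv.
- by split=> [/is_grad_unique|->]; [apply; exact: gradP | exact: gradP].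
- apply: le_trans (lip y z yr zr ys zs) _; rewrite ler_wpM2r ?enorm_ge0 //.
  by rewrite (le_trans (ler_norm L)) // lerDl.
- exact: mono.
exists y; split=> //; rewrite grad0 subr0 -vE (enormB v).
move: wy; rewrite /vbar subr0; set w := x - xbar - q => wy.
have := enorm_ge0 w; rewrite le_eqVlt => /predU1P[<-|w0].
  by rewrite mulr_ge0 ?enorm_ge0 ?ltW.
rewrite -(ler_pM2r w0) -expr2; apply: le_trans wy _.
by rewrite -mulrA ler_pM2l // dot_le.
Qed.
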